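(* Let $\mathbb{K}$ be an infinite field. Then the class of $\mathbb{K}$-representable matroids is not pigeonhole.
   Context: All matroids are finite. For a matroid $M$ and $U\subseteq E(M)$, let $\lambda_M(U)=r_M(U)+r_M(E(M)-U)-r(M)$. For $X,X'\subseteq U$, write $X\sim_U X'$ if for every $Z\subseteq E(M)-U$, $X\cup Z$ is independent in $M$ iff $X'\cup Z$ is independent in $M$. A subcubic tree is a tree in which every vertex has degree three or one; degree-one vertices are leaves. A decomposition of $M$ is a pair $(T,\varphi)$ with $T$ a subcubic tree and $\varphi$ a bijection from $E(M)$ to the leaves of $T$. Deleting an edge $e$ of $T$ splits the leaves into two parts, giving a partition $(U_e,V_e)$ of $E(M)$; the sets $U_e$ and $V_e$ are displayed by $e$. The branch-width $\mathrm{bw}(M)$ is the minimum over decompositions $(T,\varphi)$ of the maximum of $\lambda_M(U_e)+1$ over edges $e$ of $T$. The decomposition-width $\mathrm{dw}(M)$ is the minimum over decompositions $(T,\varphi)$ of the maximum number of equivalence classes of $\sim_U$ over all sets $U$ displayed by an edge of $T$. A class $\mathcal{M}$ of matroids is pigeonhole if for every positive integer $\lambda$ there is an integer $\rho(\lambda)$ such that $\mathrm{bw}(M)\le\lambda$ implies $\mathrm{dw}(M)\le\rho(\lambda)$ for every $M\in\mathcal{M}$. *)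

(* Defs.v *)
From mathcomp Require Import boolp classical_sets cardinality.
From mathcomp Require Import all_boot all_order all_algebra.

Set Implicit Arguments.
Unset Strict Implicit.
Unset Printing Implicit Defensive.

(* [set x | _] and the like denote finite sets ({set T}); classical sets are
   always marked with %classic. *)
Local Open Scope set_scope.

Record matroid (E : finType) := Matroid {
  indep : {set E} -> bool;
  indep_set0 : indep set0;
  indep_sub : forall X Y : {set E}, X \subset Y -> indep Y -> indep X;
  indep_augment : forall X Y : {set E}, indep X -> indep Y -> #|X| < #|Y| ->
    exists2 y, y \in Y :\: X & indep (y |: X) }.

Definition rank (E : finType) (M : matroid E) (U : {set E}) : nat :=
  \max_(X : {set E} | (X \subset U) && indep M X) #|X|.

(* The truncated subtraction is harmless: the rank function is subadditive. *)
Definition connectivity (E : finType) (M : matroid E) (U : {set E}) : nat :=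
  rank M U + rank M (~: U) - rank M [set: E].

Definition sim (E : finType) (M : matroid E) (U : {set E}) : rel {set E} :=
  [rel X X' | [forall Z : {set E}, (Z \subset ~: U) ==>
                (indep M (X :|: Z) == indep M (X' :|: Z))]].

Definition num_classes (E : finType) (M : matroid E) (U : {set E}) : nat :=
  #|equivalence_partition (sim M U) (powerset U)|.

Definition degree (V : finType) (e : rel V) (v : V) : nat := #|[set w | e v w]|.

Definition is_leaf (V : finType) (e : rel V) (v : V) : bool := degree e v == 1.

(* [ucycle e c] with [size c <= 2] only traverses a vertex or an edge. *)
Definition is_tree (V : finType) (e : rel V) : Prop :=
  [/\ symmetric e,
      irreflexive e,
      0 < #|V|,
      forall x y : V, connect e x y
    & forall c : seq V, ucycle e c -> size c <= 2].

Definition is_subcubic_tree (V : finType) (e : rel V) : Prop :=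
  is_tree e /\ forall v : V, degree e v = 3 \/ degree e v = 1.

Record decomposition (E : finType) := Decomposition {
  dec_vertex : finType;
  dec_edge : rel dec_vertex;
  dec_map : E -> dec_vertex;
  dec_subcubic : is_subcubic_tree dec_edge;
  dec_map_inj : injective dec_map;
  dec_map_leaves : dec_map @: [set: E] = [set v | is_leaf dec_edge v] }.

Definition delete_edge (V : finType) (e : rel V) (u v : V) : rel V :=
  [rel x y | e x y && ([set x; y] != [set u; v])].

(* The part of the partition given by the edge uv lying on the side of u; the
   other part is [displayed v u]. *)
Definition displayed (E : finType) (D : decomposition E)
    (u v : dec_vertex D) : {set E} :=
  [set x | connect (delete_edge (@dec_edge _ D) u v) u (dec_map D x)].

(* Maximum of f over the sets displayed by the edges of D; an edge is met once
   for each of its two orientations, hence with each of its two parts. *)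
Definition max_displayed (E : finType) (D : decomposition E)
    (f : {set E} -> nat) : nat :=
  \max_(uv : dec_vertex D * dec_vertex D | dec_edge uv.1 uv.2)
    f (displayed uv.1 uv.2).

(* Minimum over all decompositions. If #|E| <= 1 there is no decomposition, and
   the value is 0. *)
Definition min_decomposition (E : finType) (w : decomposition E -> nat) : nat :=
  xget 0 [set k | (exists D, w D = k) /\ (forall D, k <= w D)]%classic.

Definition branch_width (E : finType) (M : matroid E) : nat :=
  min_decomposition
    (fun D : decomposition E => max_displayed D (fun U => connectivity M U + 1)).

Definition decomposition_width (E : finType) (M : matroid E) : nat :=
  min_decomposition
    (fun D : decomposition E => max_displayed D (num_classes M)).

Definition matroid_class := forall E : finType, matroid E -> Prop.

Definition pigeonhole_class (C : matroid_class) : Prop :=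
  forall lambda : nat, 0 < lambda ->
  exists rho : nat, forall (E : finType) (M : matroid E),
    C E M -> branch_width M <= lambda -> decomposition_width M <= rho.

(* [free] is applied to the family of vectors indexed by X, so that parallel
   elements, possibly represented by equal vectors, are dependent. *)
Definition representable (K : fieldType) : matroid_class :=
  fun E M => exists (n : nat) (f : E -> 'cV[K]_n),
    forall X : {set E}, indep M X = free [seq f x | x in X].

(* Main.v *)
Require Import Defs.
From mathcomp Require Import boolp classical_sets cardinality.
From mathcomp Require Import all_boot all_order all_algebra.
From mathcomp Require Import zify ring.

(** A matroid of rank at most 3 has branch-width at most 4, since the
connectivity of a set never exceeds the rank of its complement.  So it is enough
to represent over an infinite field K matroids of rank 3 whose
decomposition-width is unbounded.

Given x_i and y_j in K (i, j < m) whose differences y_j - x_i are pairwise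
distinct, which exist because K is infinite, take the points
a_i = (1, 0, x_i), b_j = (1, 1, y_j) and c_ij = (0, 1, y_j - x_i) of the
projective plane.  Since b_j - a_i = (0, 1, y_j - x_i), the triple
{a_i, b_j, c_p} is dependent exactly when p = (i, j) ([config_indep]).  If two
points of such a collinear triple lie in U and the third one, z, does not, then
z tells the class of that pair under sim from those of the pairs of the same kind
that have another third point ([leq_num_classes]); hence many triples split by a
partition force many classes.

Every decomposition has an edge with at least a third of the m^2 points c_ij on
either side U, ~: U ([balanced_edge]): from any edge walk towards the heavier
side until the two sides balance.  Put m = 10 k.  Then U or ~: U has at least k
classes ([classes_balanced]):
- if one of them, say U, has k of the a_i and the other has k of the b_j, then
  ([classes_mixed]) either each of those b_j is the third point of a triple whose
  other two points are in U, or some b_j misses this, and then all of those a_i are third points of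
  triples {a_i, b_j, c_ij} whose other two points are in ~: U;
- otherwise, up to exchanging U and ~: U, the set U has fewer than k of the a_i
  and fewer than k of the b_j, so at least m^2 / 3 - 2 m k >= k of the points
  c_ij of U have both a_i and b_j in ~: U ([classes_few]).

A set of at least two elements does have a decomposition
([decomposition_exists]), so the minimum that defines the decomposition-width is
attained and is not the default value 0. *)

Set Implicit Arguments.
Unset Strict Implicit.
Unset Printing Implicit Defensive.
Local Open Scope set_scope.

(** * The two sides of an edge of a tree *)

Section TreeSides.
Variables (V : finType) (e : rel V).
Hypothesis treeT : is_tree e.

Let eC : symmetric e. Proof. by case: treeT. Qed.
Let e_irr : irreflexive e. Proof. by case: treeT. Qed.
Let e_conn x y : connect e x y. Proof. by case: treeT. Qed.
Let e_acyclic c : ucycle e c -> size c <= 2.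
Proof. by case: treeT => _ _ _ _; apply. Qed.

Definition side (u v : V) : {set V} := [set x | connect (delete_edge e u v) u x].

Lemma delete_edge_avoid (u v x y : V) : x != u -> y != u ->
  e x y -> delete_edge e u v x y.
Proof.
move=> xu yu exy; rewrite /delete_edge /= exy /=.
apply/eqP => /setP /(_ u); rewrite !inE eqxx (eq_sym u x) (eq_sym u y).
by rewrite (negPf xu) (negPf yu).
Qed.

Lemma delete_edgeC (u v : V) : delete_edge e u v =2 delete_edge e v u.
Proof. by move=> x y; rewrite /delete_edge /= (setUC [set u]). Qed.

Lemma delete_edge_connectC (u v : V) : connect_sym (delete_edge e u v).
Proof.
by apply: sym_connect_sym => x y; rewrite /delete_edge /= eC (setUC [set x]).
Qed.

Lemma side_root (u v : V) : u \in side u v.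
Proof. by rewrite inE connect0. Qed.

(** A path from u to v that avoids the edge uv would close up with that edge into
a cycle of length at least three. *)
Lemma side_notin (u v : V) : e u v -> v \notin side u v.
Proof.
move=> euv; rewrite inE; apply/negP => /connectP[p0 pathp0 v_last].
case/shortenP: pathp0 v_last => p pathp uniqp _ v_last.
have pathe : path e u p by apply: sub_path pathp => x y /andP[].
have : ucycle e (u :: p).
  by rewrite /ucycle /cycle rcons_path pathe -v_last eC euv.
move/e_acyclic; case: p pathp v_last {pathe uniqp} => [|x [|y p]] //=.
  by move=> _ vu _; rewrite vu e_irr in euv.
by move=> /andP[/andP[_ /eqP ne] _] vx _; case: ne; rewrite vx.
Qed.

Lemma path_avoid_delete (u v w : V) (q : seq V) :
  path e w q -> u \notin w :: q -> path (delete_edge e u v) w q.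
Proof.
elim: q w => //= y q IH w /andP[ewy pq]; rewrite !inE !negb_or.
move=> /and3P[uw uy uq]; rewrite delete_edge_avoid 1?eq_sym //=.
by apply: IH; rewrite // inE negb_or uy.
Qed.

Lemma mem_side_path (u w : V) (q : seq V) :
  path e w q -> u \notin w :: q -> last w q \in side w u.
Proof.
move=> pq uq; rewrite inE (eq_connect (delete_edgeC w u)).
by apply/connectP; exists q => //; apply: path_avoid_delete.
Qed.

(** Disjointness comes from acyclicity ([side_notin]), exhaustiveness from
connectedness: a simple path from u either starts with the edge uv, and then
never returns to u, or never uses that edge. *)
Lemma side_compl (u v : V) : e u v -> side v u = ~: side u v.
Proof.
move=> euv; apply/setP => x; rewrite in_setC.
apply/idP/idP => [xv|].
  apply/negP => xu; have /negP := side_notin euv; apply; move: xu xv.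
  rewrite !inE => xu; rewrite (eq_connect (delete_edgeC v u)).
  by rewrite delete_edge_connectC; apply: connect_trans.
have /connectP[p0 pathp0 x_last] := e_conn u x.
case/shortenP: pathp0 x_last => [[|w q]] /=.
  by move=> _ _ _ ->; rewrite side_root.
move=> /andP[euw pq] /andP[uq _] _ ->; have [vw|vw] := eqVneq w v.
  by move=> _; rewrite -vw; apply: mem_side_path.
rewrite inE => /negP[]; apply: (@connect_trans _ _ w); last first.
  by apply/connectP; exists q => //; apply: path_avoid_delete.
apply: connect1; rewrite /delete_edge /= euw; apply/eqP => /setP /(_ v).
rewrite !inE eqxx orbT [v == w]eq_sym (negPf vw) orbF => /eqP vu.
by rewrite vu e_irr in euv.
Qed.

Lemma side_step (u v x : V) : x \in side u v ->
  x = u \/ exists w, [/\ e u w, w != v & x \in side w u].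
Proof.
rewrite inE => /connectP[p0 pathp0 x_last].
case/shortenP: pathp0 x_last => [[|w q]] /=; first by left.
move=> /andP[/andP[euw ne] pq] /andP[uq _] _ ->; right; exists w.
split=> //; first by apply: contraNneq ne => ->.
by apply: mem_side_path => //; apply: sub_path pq => ? ? /andP[].
Qed.

(** This makes the walk towards the heavier side in [balanced_edge] terminate. *)
Lemma side_proper (u v w : V) : e u v -> e u w -> w != v ->
  side w u \proper side u v.
Proof.
move=> euv euw wv; apply/properP; split; last first.
  by exists u; [exact: side_root | rewrite side_notin // eC].
apply/subsetP => x; rewrite inE => /connectP[p pathp ->].
have uq : u \notin w :: p.
  apply/negP => /splitPl up; case: p / up pathp => p1 p2 last_p1.
  rewrite cat_path => /andP[pathp1 _].
  have /negP := @side_notin w u (etrans (eC w u) euw); apply; rewrite inE.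
  by apply/connectP; exists p1.
rewrite inE; apply: (@connect_trans _ _ w); last first.
  apply/connectP; exists p => //; apply: path_avoid_delete => //.
  by apply: sub_path pathp => ? ? /andP[].
apply: connect1; rewrite /delete_edge /= euw; apply/eqP => /setP /(_ w).
rewrite !inE eqxx orbT (negPf wv) orbF => /esym/eqP wu.
by rewrite wu e_irr in euw.
Qed.

Lemma side_degree1 (u v : V) : e u v -> degree e u = 1 -> side u v = [set u].
Proof.
move=> euv /eqP/cards1P[w nbrs]; apply/eqP; rewrite eqEsubset sub1set side_root.
rewrite andbT; apply/subsetP => x /side_step[->|[y [euy yv _]]].
  by rewrite inE.
move: (euv) (euy) yv; rewrite -[e u v](in_set (e u)) -[e u y](in_set (e u)).
by rewrite nbrs !inE => /eqP-> ->.
Qed.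

Lemma side_degree3 (u v : V) : e u v -> degree e u = 3 ->
  exists w w', [/\ e u w, e u w', w != v, w' != v &
    side u v = u |: (side w u :|: side w' u)].
Proof.
move=> euv deg; have : #|[set w | e u w] :\ v| == 2.
  by move/eqP: deg; rewrite /degree (cardsD1 v) inE euv add1n eqSS.
move=> /cards2P[w [w' [_ nbrs]]]; exists w, w'.
have nb y : (y != v) && e u y = (y == w) || (y == w').
  by have /setP/(_ y) := nbrs; rewrite !inE.
have /andP[wv euw] : (w != v) && e u w by rewrite nb eqxx.
have /andP[wv' euw'] : (w' != v) && e u w' by rewrite nb eqxx orbT.
split=> //; apply/eqP; rewrite eqEsubset !subUset sub1set side_root.
rewrite !(proper_sub (side_proper _ _ _)) // !andbT.
apply/subsetP => x /side_step[->|[y [euy yv xy]]]; first by rewrite !inE eqxx.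
have : (y == w) || (y == w') by rewrite -nb yv.
by case/orP => /eqP yw; rewrite -yw !in_setU xy !orbT.
Qed.

End TreeSides.

(** * A balanced edge in a decomposition *)

Section Balanced.
Variables (E : finType) (D : decomposition E).
Let e := @dec_edge _ D.
Let treeD : is_tree e. Proof. by case: (dec_subcubic D). Qed.

Lemma displayedE (u v : dec_vertex D) :
  displayed u v = @dec_map _ D @^-1: side e u v.
Proof. by apply/setP => x; rewrite !inE. Qed.

Lemma displayedC (u v : dec_vertex D) : e u v -> displayed v u = ~: displayed u v.
Proof. by move=> euv; rewrite !displayedE side_compl // preimsetC. Qed.

Lemma displayed_leaf (u v : dec_vertex D) : e u v -> degree e u = 1 ->
  #|displayed u v| <= 1.
Proof.
move=> euv deg; rewrite displayedE side_degree1 //.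
apply/card_le1_eqP => x y; rewrite !inE => /eqP xu /eqP yu.
by apply: (@dec_map_inj _ D); rewrite yu.
Qed.

(** No element of E is mapped to the branching vertex u itself, so the side of u
is made up of the two sides beyond its other neighbours. *)
Lemma displayed_branch (u v : dec_vertex D) : e u v -> degree e u = 3 ->
  exists w w', [/\ e u w, e u w', w != v, w' != v &
    displayed u v = displayed w u :|: displayed w' u].
Proof.
move=> euv deg; have [w [w' [? ? ? ? sideE]]] := side_degree3 treeD euv deg.
exists w, w'; split=> //; rewrite !displayedE sideE !preimsetU.
rewrite [_ @^-1: [set u]](_ : _ = set0) ?set0U //.
apply/setP => x; rewrite !inE; apply/negP => /eqP xu.
have /setP/(_ u) := dec_map_leaves D; rewrite -{1}xu imset_f ?inE //.
by rewrite /is_leaf -/e deg.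
Qed.

(** If the side of u holds more than two thirds of S, then u is not a leaf, as
|S| >= 2, and one of the two smaller sides that make up the side of u still
holds a third of S. *)
Lemma balanced_edge (S : {set E}) : 2 <= #|S| ->
  exists u v, [/\ e u v, #|S| <= 3 * #|S :&: displayed u v|
    & #|S| <= 3 * #|S :&: ~: displayed u v|].
Proof.
move=> S2.
have split_S (U : {set E}) : #|S :&: U| + #|S :&: ~: U| = #|S|.
  by rewrite -setDE cardsID.
have descend n u v : #|side e u v| < n -> e u v ->
  #|S| <= 3 * #|S :&: displayed u v| ->
  exists u v, [/\ e u v, #|S| <= 3 * #|S :&: displayed u v|
    & #|S| <= 3 * #|S :&: ~: displayed u v|].
  elim: n u v => // n IH u v small euv big.
  have [?|unbal] := leqP #|S| (3 * #|S :&: ~: displayed u v|).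
    by exists u, v.
  have {}unbal : 2 * #|S| < 3 * #|S :&: displayed u v|.
    by have := split_S (displayed u v); lia.
  have [_ /(_ u)[deg|deg]] := dec_subcubic D; last first.
    have := subset_leq_card (subsetIr S (displayed u v)).
    by have := displayed_leaf euv deg; lia.
  have [w [w' [euw euw' wv wv' dispE]]] := displayed_branch euv deg.
  have eC : symmetric e by case: treeD.
  have [bigw|smallw] := leqP #|S| (3 * #|S :&: displayed w u|).
    apply: (IH w u) => //; last by rewrite eC.
    by have := proper_card (side_proper treeD euv euw wv); lia.
  apply: (IH w' u); last 2 first.
  - by rewrite eC.
  - rewrite dispE setIUr in unbal.
    have := cardsU (S :&: displayed w u) (S :&: displayed w' u); lia.
  by have := proper_card (side_proper treeD euv euw' wv'); lia.
have /card_gt0P[x _] : 0 < #|S| by lia.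
pose u := dec_map D x.
have /card_gt0P[v] : 0 < #|[set v | e u v]|.
  by case: (dec_subcubic D) => _ /(_ u)[]; rewrite /degree -/e => ->.
rewrite inE => euv.
have [?|?] := leqP #|S| (3 * #|S :&: displayed u v|).
  exact: (descend _ _ _ (ltnSn _) euv).
apply: (descend _ _ _ (ltnSn _) (etrans _ euv)); first by case: treeD.
by rewrite displayedC //; have := split_S (displayed u v); lia.
Qed.

End Balanced.

(** * A subcubic tree with a given number of leaves

The binary heap on 1, ..., 2k - 1, in which the parent of i is i./2, has for
k > 1 a root of degree two; the extra vertex 0 = 1./2 hanging from that root makes the tree
subcubic, with leaves 0 and k, ..., 2k - 1. *)

Section HeapTree.
Variable k : nat.
Hypothesis k_gt0 : 0 < k.
Let V := 'I_(k.*2).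

Definition heap_rel : rel V :=
  [rel i j : V | (i != j) && ((i == j./2 :> nat) || (j == i./2 :> nat))].

Let root : V := Ordinal (etrans (double_gt0 k) k_gt0).

Lemma heap_relC : symmetric heap_rel.
Proof. by move=> i j; rewrite /heap_rel /= eq_sym orbC. Qed.

Lemma heap_parent (i j : V) : heap_rel i j -> j < i -> j = i./2 :> nat.
Proof. by move=> /andP[_ /orP[]/eqP] // h; lia. Qed.

Lemma heap_connect_root (i : V) : connect heap_rel root i.
Proof.
case: i => i; elim/ltn_ind: i => -[|i] IH ltik.
  by rewrite (_ : Ordinal ltik = root) ?connect0 //; apply: val_inj.
have lt2i : i.+1./2 < i.+1 by lia.
apply: connect_trans (IH _ lt2i (ltn_trans lt2i ltik)) (connect1 _).
by rewrite /heap_rel /= -val_eqE /=; lia.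
Qed.

(** The two neighbours of the largest vertex of a cycle are both its parent. *)
Lemma heap_acyclic (c : seq V) : ucycle heap_rel c -> size c <= 2.
Proof.
case: c => // z0 c0; set c := z0 :: c0 => /andP[cyc uniqc].
have [i ic imax] := @arg_maxnP _ z0 (mem c) val (mem_head _ _).
case/rot_to: ic => n [|y [|z p]] rotc; rewrite -(size_rot n) rotc //.
have in_c x : x \in c = (x \in [:: i, y, z & p]) by rewrite -rotc mem_rot.
have : cycle heap_rel [:: i, y, z & p] by rewrite -rotc rot_cycle.
have : uniq [:: i, y, z & p] by rewrite -rotc rot_uniq.
rewrite /cycle -cats1 cat_path [uniq _]/= => /and3P[iyzp yzp _] /andP[/andP[iy _]].
rewrite /= andbT => li; have lastin : last z p \in z :: p by apply: mem_last.
have below x : x \in [:: y, z & p] -> x < i.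
  move=> xin; rewrite ltn_neqAle; apply/andP; split; last first.
    by apply: imax; rewrite /= in_c inE xin orbT.
  by apply: contraNneq iyzp => /val_inj <-.
have yE := heap_parent iy (below _ (mem_head _ _)).
rewrite heap_relC in li.
have lE := heap_parent li (below _ _); rewrite inE lastin orbT in lE.
by case/negP: yzp; rewrite (_ : y = last z p) //; apply: val_inj; rewrite /= yE lE.
Qed.

Lemma heap_tree : is_tree heap_rel.
Proof.
split; [exact: heap_relC | by move=> i; rewrite /heap_rel /= eqxx | | | exact: heap_acyclic].
- by rewrite card_ord double_gt0.
- move=> x y; apply: connect_trans (heap_connect_root y).
  by rewrite (sym_connect_sym heap_relC) heap_connect_root.
Qed.

Lemma heap_degree (i : V) :
  degree heap_rel i = if (0 < i) && (i < k) then 3 else 1.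
Proof.
have ltk (j : V) := ltn_ord j.
rewrite /degree; have [->|i0] := eqVneq i root.
  rewrite /=; have lt1 : 1 < k.*2 by lia.
  rewrite [X in #|pred_of_set X|](_ : _ = [set Ordinal lt1]) ?cards1 //.
  by apply/setP => j; rewrite !inE /heap_rel /= -!val_eqE /=; have := ltk j; lia.
have {}i0 : 0 < i by rewrite lt0n -val_eqE in i0 *.
have lth : i./2 < k.*2 by have := ltk i; lia.
rewrite i0 /=; case: ltnP => ik; last first.
  rewrite [X in #|pred_of_set X|](_ : _ = [set Ordinal lth]) ?cards1 //.
  by apply/setP => j; rewrite !inE /heap_rel /= -!val_eqE /=; have := ltk j; lia.
have lt0 : i.*2 < k.*2 by lia.
have lt1 : i.*2.+1 < k.*2 by lia.
rewrite [X in #|pred_of_set X|]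
  (_ : _ = [set Ordinal lth; Ordinal lt0; Ordinal lt1]).
  by rewrite setUC !cardsU1 cards1 !inE -!val_eqE /=; lia.
by apply/setP => j; rewrite !inE /heap_rel /= -!val_eqE /=; have := ltk j; lia.
Qed.

Lemma heap_subcubic : is_subcubic_tree heap_rel.
Proof.
by split=> [|v]; [exact: heap_tree | rewrite heap_degree; case: ifP; [left|right]].
Qed.

End HeapTree.

Lemma decomposition_exists (E : finType) : 1 < #|E| -> inhabited (decomposition E).
Proof.
move=> E2; pose k := #|E|.-1; have k_gt0 : 0 < k by rewrite /k; lia.
have ltf (x : E) : (if enum_rank x == 0 :> nat then 0 else k.-1 + enum_rank x) < k.*2.
  by have : enum_rank x < #|E| := ltn_ord _; case: ifP; rewrite /k; lia.
pose f x := Ordinal (ltf x).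
have f_inj : injective f.
  move=> x y /(congr1 val) /= fxy; apply/enum_rank_inj/val_inj => /=.
  by move: fxy; do 2!case: ifP; lia.
constructor; apply: (Decomposition (heap_subcubic k_gt0) f_inj).
apply/setP => i; rewrite inE /is_leaf heap_degree //.
have ltE : (if i == 0 :> nat then 0 else i - k.-1) < #|E|.
  by case: ifP => // _; first lia; have := ltn_ord i; rewrite /k; lia.
apply/imsetP/idP => [[x _ ->]|leaf].
  by rewrite /=; case: (nat_of_ord (enum_rank x)) => [|r] //=; case: ifP; lia.
exists (enum_val (Ordinal ltE)) => //; apply: val_inj; rewrite /= enum_valK /=.
by move: leaf; do !case: ifP; lia.
Qed.

(** * Telling classes apart *)

(** For s and t distinct, z t completes X t, but not X s, to a dependent
set, so the sets X t are pairwise inequivalent. *)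
Lemma leq_num_classes (E I : finType) (M : matroid E) (U : {set E})
    (S : {set I}) (X : I -> {set E}) (z : I -> E) :
    {in S, forall t, X t \subset U} -> {in S, forall t, z t \notin U} ->
    {in S &, forall s t, indep M (z t |: X s) = (s != t)} ->
  #|S| <= num_classes M U.
Proof.
move=> XU zU indepE; pose cl X0 := [set Y in powerset U | sim M U X0 Y].
have cl_inj : {in S &, injective (cl \o X)}.
  move=> s t sS tS /= /setP /(_ (X s)); rewrite !inE XU //=.
  rewrite [X in X = _](_ : _ = true); last by apply/forallP => Z; apply/implyP.
  move=> /esym/forallP /(_ [set z t]).
  rewrite sub1set inE zU //= setUC [X s :|: _]setUC !indepE // eqxx.
  by move=> /eqP/esym/negbFE/eqP.
rewrite -(card_in_imset cl_inj); apply/subset_leq_card/subsetP.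
move=> _ /imsetP[t tS ->]; rewrite /equivalence_partition.
by apply/imsetP; exists (X t); rewrite // powersetE XU.
Qed.

(** * Matroids of vector configurations *)

Section VectorMatroid.
Variables (K : fieldType) (vT : vectType K) (E : finType) (f : E -> vT).

Definition vec_indep (X : {set E}) : bool := free [seq f x | x in X].

Lemma vec_indepE (s : seq E) : uniq s ->
  vec_indep [set x in s] = free [seq f x | x <- s].
Proof.
move=> uniqs; rewrite /vec_indep; apply/perm_free/perm_map/uniq_perm => //.
  exact: enum_uniq.
by move=> x; rewrite mem_enum inE.
Qed.

Lemma vec_indepU1 (x : E) (X : {set E}) : x \notin X ->
  vec_indep (x |: X) = (f x \notin <<[seq f x | x in X]>>%VS) && vec_indep X.
Proof.
move=> xX; rewrite [vec_indep X]/vec_indep -free_cons.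
rewrite -[_ :: _]/(map f (x :: enum X)) -vec_indepE /=; last first.
  by rewrite mem_enum xX enum_uniq.
by congr vec_indep; apply/setP => y; rewrite !inE mem_enum.
Qed.

Lemma vec_indep0 : vec_indep set0.
Proof. by rewrite /vec_indep /image_mem enum_set0 nil_free. Qed.

Lemma vec_indepS (X Y : {set E}) : X \subset Y -> vec_indep Y -> vec_indep X.
Proof.
move=> XY; have -> : Y = [set x in enum X ++ enum (Y :\: X)].
  apply/setP => x; rewrite inE mem_cat !mem_enum inE.
  by case: (boolP (x \in X)) => //= /(subsetP XY).
rewrite vec_indepE ?map_cat => [/catl_free //|].
rewrite cat_uniq !enum_uniq andbT /= -all_predC; apply/allP => x.
by rewrite /= !mem_enum inE => /andP[].
Qed.

Lemma vec_indep_augment (X Y : {set E}) :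
    vec_indep X -> vec_indep Y -> #|X| < #|Y| ->
  exists2 y, y \in Y :\: X & vec_indep (y |: X).
Proof.
move=> indX indY ltXY.
have [/subvP sYX|] := boolP (<<[seq f x | x in Y]>> <= <<[seq f x | x in X]>>)%VS.
  have := dimvS (introT subvP sYX); rewrite (eqP indX) (eqP indY) !size_map.
  by rewrite -!cardE leqNgt ltXY.
case/subvPn => w wY wX.
have /subsetPn[y yY yX] : ~~ (Y \subset [set y | f y \in <<[seq f x | x in X]>>%VS]).
  apply: contra wX => /subsetP YX; move: wY; apply/subvP/span_subvP => v.
  by case/imageP => y /YX; rewrite inE => ? ->.
rewrite inE in yX; have yX' : y \notin X.
  by apply: contra yX => yX'; apply: memv_span; apply: image_f.
by exists y; rewrite ?vec_indepU1 ?yX // inE yX' yY.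
Qed.

Definition vec_matroid := Matroid vec_indep0 vec_indepS vec_indep_augment.

Lemma vec_indep_card (X : {set E}) : vec_indep X -> #|X| <= \dim {:vT}.
Proof.
by move=> /eqP; rewrite size_map -cardE => <-; apply/dimvS/subvf.
Qed.

End VectorMatroid.

(** * Bounding the two widths *)

Lemma leq_connectivity_rank (E : finType) (M : matroid E) (U : {set E}) :
  connectivity M U <= rank M (~: U).
Proof.
rewrite leq_subLR leq_add2r; apply/bigmax_leqP => X /andP[_ indX].
by apply: (@leq_bigmax_cond _ _ (fun X : {set E} => #|X|)); rewrite subsetT.
Qed.

Lemma branch_width_leq (E : finType) (M : matroid E) (r : nat) :
  (forall X, indep M X -> #|X| <= r) -> branch_width M <= r.+1.
Proof.
move=> rankM; rewrite /branch_width /min_decomposition.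
case: xgetP => // _ _ [[D <-] _]; apply/bigmax_leqP => uv _.
rewrite addn1 ltnS; apply: leq_trans (leq_connectivity_rank _ _) _.
by apply/bigmax_leqP => X /andP[_]; apply: rankM.
Qed.

Lemma min_decomposition_attained (E : finType) (w : decomposition E -> nat) :
  1 < #|E| -> exists D, min_decomposition w = w D.
Proof.
move=> /decomposition_exists[D0].
have ex : exists k, `[< exists D, w D = k >] by exists (w D0); apply/asboolP; exists D0.
rewrite /min_decomposition; case: xgetP => [_ _ [[D <-] _]|]; first by exists D.
case: (ex_minnP ex) => k /asboolP[D wD] kmin /(_ k)[]; split; first by exists D.
by move=> D'; apply: kmin; apply/asboolP; exists D'.
Qed.

(** The maximum over a decomposition sees both sides of its balanced edge. *)
Lemma leq_decomposition_width (E : finType) (M : matroid E) (S : {set E}) (k : nat) :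
    1 < #|S| ->
    (forall U, #|S| <= 3 * #|S :&: U| -> #|S| <= 3 * #|S :&: ~: U| ->
      k <= maxn (num_classes M U) (num_classes M (~: U))) ->
  k <= decomposition_width M.
Proof.
move=> S2 manyU; rewrite /decomposition_width.
have [D ->] := min_decomposition_attained (fun D => max_displayed D (num_classes M))
  (leq_trans S2 (max_card _)).
have [u [v [euv SU SV]]] := balanced_edge D S2.
apply: leq_trans (manyU _ SU SV) _; rewrite geq_max /max_displayed.
apply/andP; split; first exact: (leq_bigmax_cond (u, v)).
rewrite -displayedC //; apply: (leq_bigmax_cond (v, u)).
by have [[eC _ _ _ _] _] := dec_subcubic D; rewrite /= eC.
Qed.

(** * Partitions splitting many collinear triples *)

Section Triangles.
Variables (E I : finType) (M : matroid E) (a b : I -> E) (c : I * I -> E).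
Hypothesis indep_abc : forall i j p,
  indep M [set a i; b j; c p] = (p != (i, j)).

Lemma classes_ab (U : {set E}) :
  #|[set p | [&& a p.1 \in U, b p.2 \in U & c p \notin U]]| <= num_classes M U.
Proof.
apply: (@leq_num_classes _ _ _ _ _ (fun p => [set a p.1; b p.2]) c).
- move=> p; rewrite inE => /and3P[ap bp _].
  by rewrite subUset !sub1set ap.
- by move=> p; rewrite inE => /and3P[].
- by move=> p q _ _; rewrite /= setUC indep_abc -surjective_pairing eq_sym.
Qed.

Lemma classes_ac (U : {set E}) (f : I -> I) :
  #|[set j | [&& a (f j) \in U, c (f j, j) \in U & b j \notin U]]| <=
  num_classes M U.
Proof.
apply: (@leq_num_classes _ _ _ _ _ (fun j => [set a (f j); c (f j, j)]) b).
- move=> j; rewrite inE => /and3P[aj cj _].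
  by rewrite subUset !sub1set aj.
- by move=> j; rewrite inE => /and3P[].
- move=> j l _ _; rewrite setUCA setUA indep_abc.
  by rewrite xpair_eqE eqxx.
Qed.

Lemma classes_bc (U : {set E}) (j : I) :
  #|[set i | [&& b j \in U, c (i, j) \in U & a i \notin U]]| <=
  num_classes M U.
Proof.
apply: (@leq_num_classes _ _ _ _ _ (fun i => [set b j; c (i, j)]) a).
- move=> i; rewrite inE => /and3P[bj ci _].
  by rewrite subUset !sub1set bj.
- by move=> i; rewrite inE => /and3P[].
- move=> i l _ _; rewrite setUA indep_abc.
  by rewrite xpair_eqE eqxx andbT.
Qed.

(** Let f send each j to a witness i with a i and c (i, j) in U, if there is
one: when this succeeds for every b j outside U, the pairs a (f j), c (f j, j)
are in distinct classes for distinct such j.  A single failing j makes c (i, j)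
lie outside U for every a i in U. *)
Lemma classes_mixed (U : {set E}) (k : nat) :
    k <= #|[set i | a i \in U]| -> k <= #|[set j | b j \notin U]| ->
  k <= maxn (num_classes M U) (num_classes M (~: U)).
Proof.
move=> kA kB; rewrite leq_max.
have [ex|] := boolP [forall (j | b j \notin U), exists i, (a i \in U) && (c (i, j) \in U)].
  pose f j := odflt j [pick i | (a i \in U) && (c (i, j) \in U)].
  apply/orP; left; apply: leq_trans kB (leq_trans _ (classes_ac U f)).
  apply/subset_leq_card/subsetP => j; rewrite !inE => bj; rewrite bj /f.
  case: pickP => [i /andP[-> ->] //|none].
  by have /existsP[i] := implyP (forallP ex j) bj; rewrite none.
case/forall_inPn => j bj /existsPn none.
apply/orP; right; apply: leq_trans kA (leq_trans _ (classes_bc (~: U) j)).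
apply/subset_leq_card/subsetP => i; rewrite !inE => ai.
by have := none i; rewrite ai andbT /= => ->; rewrite andbT; apply: bj.
Qed.

(** Each a i or b j in U accounts for at most |I| of the points c (i, j) of U, so
at least k of these points are left with both a i and b j outside U. *)
Lemma classes_few (U : {set E}) (k : nat) :
    #|[set i | a i \in U]| < k -> #|[set j | b j \in U]| < k ->
    (2 * #|I| + 1) * k <= #|[set p | c p \in U]| ->
  k <= num_classes M (~: U).
Proof.
move=> Ak Bk Ck; apply: leq_trans (classes_ab (~: U)).
set P := [set p | _]; set A := [set i | _] in Ak; set B := [set j | _] in Bk.
have /subset_leq_card : [set p | c p \in U] \subset P :|: setX A setT :|: setX setT B.
  apply/subsetP => -[i j]; rewrite !inE /= => ->.
  by case: (a i \in U); case: (b j \in U).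
have := cardsU (P :|: setX A setT) (setX setT B).
have := cardsU P (setX A setT); rewrite !cardsX cardsT.
have := ltnW Ak; have := ltnW Bk; nia.
Qed.

(** The factor 10 gives room for (2 * 10 * k + 1) * k <= 100 * k ^ 2 / 3, as
[classes_few] requires. *)
Lemma classes_balanced (U : {set E}) (k : nat) :
    #|I| = 10 * k ->
    #|I| * #|I| <= 3 * #|[set p | c p \in U]| ->
    #|I| * #|I| <= 3 * #|[set p | c p \in ~: U]| ->
  k <= maxn (num_classes M U) (num_classes M (~: U)).
Proof.
move=> cardI CU CU'.
have [->//|k_gt0] := posnP k.
have compl (g : I -> E) : #|[set i | g i \in U]| + #|[set i | g i \in ~: U]| = 10 * k.
  rewrite -cardI -(cardsC [set i | g i \in U]); congr (_ + _).
  by apply: eq_card => i; rewrite !inE.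
have notin (g : I -> E) : [set i | g i \notin U] = [set i | g i \in ~: U].
  by apply/setP => i; rewrite !inE.
have cA := compl a; have cB := compl b.
have [aU|aU] := ltnP #|[set i | a i \in U]| k.
  have [bU|bU] := ltnP #|[set i | b i \in U]| k.
    rewrite leq_max (classes_few aU bU) ?orbT //.
    by rewrite -(leq_pmul2l (isT : 0 < 3)); apply: leq_trans CU; nia.
  rewrite maxnC -{2}(setCK U); apply: classes_mixed; first by lia.
  by apply: leq_trans bU _; apply: subset_leq_card; apply/subsetP => i; rewrite !inE negbK.
have [bU|bU] := ltnP #|[set i | b i \in ~: U]| k; last first.
  by apply: classes_mixed; rewrite ?notin.
have [aU'|aU'] := ltnP #|[set i | a i \in ~: U]| k.
  rewrite leq_max -{1}(setCK U) (classes_few aU' bU) //.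
  by rewrite -(leq_pmul2l (isT : 0 < 3)); apply: leq_trans CU'; nia.
rewrite maxnC -{2}(setCK U); apply: classes_mixed => //.
rewrite (_ : [set j | _] = [set i | b i \in U]); first by lia.
by apply/setP => i; rewrite !inE negbK.
Qed.

End Triangles.

(** * The rank-three configuration *)

Section Configuration.
Import GRing.Theory.
Local Open Scope ring_scope.
Variables (K : fieldType) (m : nat) (x y : 'I_m -> K).
Hypothesis diff_inj : injective (fun p : 'I_m * 'I_m => y p.2 - x p.1).

Definition vec3 (u v w : K) : 'cV[K]_3 := \col_(i < 3) nth 0 [:: u; v; w] i.

Lemma vec3P (u v w u' v' w' : K) :
  vec3 u v w = vec3 u' v' w' <-> [/\ u = u', v = v' & w = w'].
Proof.
split=> [/matrixP eq|[-> -> ->] //].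
by split; [have := eq 0 0 | have := eq 1 0 | have := eq 2%:R 0]; rewrite !mxE.
Qed.

Definition point : finType := ('I_m + 'I_m + 'I_m * 'I_m)%type.
Definition pta i : point := inl (inl i).
Definition ptb j : point := inl (inr j).
Definition ptc p : point := inr p.

Definition coords (t : point) : 'cV[K]_3 :=
  match t with
  | inl (inl i) => vec3 1 0 (x i)
  | inl (inr j) => vec3 1 1 (y j)
  | inr p => vec3 0 1 (y p.2 - x p.1)
  end.

Definition config_matroid : matroid point := vec_matroid coords.

(** In a combination s a_i + t b_j with first two coordinates 0 and 1 one has
t = 1 and s = -1, so c_p is on the line through a_i and b_j exactly when the
differences indexed by p and (i, j) agree. *)
Lemma config_indep i j p :
  indep config_matroid [set pta i; ptb j; ptc p] = (p != (i, j)).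
Proof.
rewrite (_ : [set _; _; _] = [set t in [:: ptc p; pta i; ptb j]]); last first.
  by apply/setP => t; rewrite !inE orbC.
rewrite /= vec_indepE //= free_cons free_cons.
have -> : free [:: coords (ptb j)].
  rewrite seq1_free; apply/eqP => /matrixP /(_ 0 0); rewrite !mxE /=.
  by apply/eqP/oner_neq0.
rewrite span_seq1 span_cons span_seq1 andbT.
have combE (s t u v w u' v' w' : K) :
  s *: vec3 u v w + t *: vec3 u' v' w' =
  vec3 (s * u + t * u') (s * v + t * v') (s * w + t * w').
  by apply/matrixP => k l; rewrite !mxE; case: k => [[|[|[|]]]].
have -> : vec3 1 0 (x i) \notin <[vec3 1 1 (y j)]>%VS.
  apply/negP => /vlineP[s /matrixP eqs]; have := eqs 0 0; have := eqs 1 0.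
  by rewrite !mxE /= !mulr1 => <- /eqP; rewrite oner_eq0.
rewrite andbT; congr negb; apply/memv_addP/eqP.
  case=> _ /vlineP[s ->] [_ /vlineP[t ->]]; rewrite combE => /vec3P[].
  rewrite !mulr0 !mulr1 add0r => /esym/eqP; rewrite addr_eq0 => /eqP-> <- e2.
  by apply: diff_inj; rewrite /= e2; ring.
move=> ->; exists (-1 *: coords (pta i)); first exact/memvZ/memv_line.
exists (1 *: coords (ptb j)); first exact/memvZ/memv_line.
by rewrite combE; apply/vec3P; split; rewrite /=; ring.
Qed.

End Configuration.

(** * Distinct differences in an infinite group *)

Lemma infinite_fresh (T : choiceType) (s : seq T) :
  infinite_set [set: T]%classic -> exists t, t \notin s.
Proof.
move=> infT; apply/not_existsP => all_s; apply: infT.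
by apply/finite_seqP; exists s; apply/seteqP; split=> t //= _; apply/negPn/negP/all_s.
Qed.

Lemma greedy_sequence (T : choiceType) (F : T -> seq T) (n : nat) :
  infinite_set [set: T]%classic ->
  exists y : nat -> T, forall j l, j < l < n -> y l \notin F (y j).
Proof.
move=> infT; elim: n => [|n [y yF]].
  have [t _] := infinite_fresh [::] infT.
  by exists (fun=> t) => j l; rewrite ltn0 andbF.
have [t tF] := infinite_fresh (flatten [seq F (y j) | j <- iota 0 n]) infT.
exists (fun l => if l == n then t else y l) => j l /andP[jl ln].
have -> : (j == n) = false by lia.
have [lE|lE] := eqVneq l n; last by apply: yF; lia.
apply: contra tF => tF; apply/flatten_mapP; exists j => //.
by rewrite mem_iota; lia.
Qed.

(** Choose the x_i distinct, and then each y_l outside the finitely many values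
y_j - x_i + x_i' with j < l. *)
Lemma distinct_differences (K : zmodType) (m : nat) :
  infinite_set [set: K]%classic ->
  exists x y : 'I_m -> K, injective (fun p : 'I_m * 'I_m => (y p.2 - x p.1)%R).
Proof.
move=> infK.
have [x xF] := greedy_sequence (fun u => [:: u]) m infK.
pose F u := [seq (u - x (val p.1) + x (val p.2))%R | p : 'I_m * 'I_m].
have [y yF] := greedy_sequence F m infK.
have neq (p q : 'I_m * 'I_m) : p.2 < q.2 -> (y q.2 - x q.1 <> y p.2 - x p.1)%R.
  move=> lt pq; have /negP := yF _ _ (introT andP (conj lt (ltn_ord _))).
  by apply; apply/imageP; exists (p.1, q.1); rewrite //= -pq GRing.subrK.
exists (fun i => x i), (fun j => y j) => -[i j] [k l] /= eq.
have jl : j = l.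
  case: (ltngtP j l) => [lt|lt|/val_inj//].
    by case: (neq (i, j) (k, l) lt).
  by case: (neq (k, l) (i, j) lt).
move: eq; rewrite jl => /GRing.addrI/GRing.oppr_inj eq; congr (_, _).
case: (ltngtP i k) => [lt|lt|/val_inj//].
  by have := xF _ _ (introT andP (conj lt (ltn_ord _))); rewrite inE eq eqxx.
by have := xF _ _ (introT andP (conj lt (ltn_ord _))); rewrite inE eq eqxx.
Qed.

(** * Unbounded decomposition-width over an infinite field *)

Theorem proposition5p2 (K : fieldType) (hK : infinite_set [set: K]%classic) :
  ~ pigeonhole_class (representable K).
Proof.
move=> /(_ 4 isT)[rho bounded].
pose m := 10 * rho.+1.
have [x [y diff_inj]] := distinct_differences m hK.
pose M := config_matroid x y.
have repM : representable K M by exists 3, (coords x y).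
have bwM : branch_width M <= 4.
  apply: branch_width_leq => X /vec_indep_card.
  by rewrite dimvf.
have := bounded _ M repM bwM; apply/negP; rewrite -ltnNge.
have card_ptc (P : {set 'I_m * 'I_m}) : #|@ptc m @: P| = #|P|.
  by apply: card_imset => p q [].
have cardS : #|@ptc m @: setT| = m * m by rewrite card_ptc cardsT card_prod card_ord.
apply: (@leq_decomposition_width _ _ (@ptc m @: setT)).
  by rewrite cardS /m; nia.
have ptcI (U : {set point m}) : #|@ptc m @: setT :&: U| = #|[set p | ptc p \in U]|.
  rewrite -card_ptc; congr #|pred_of_set _|; apply/setP => t; rewrite !inE.
  apply/andP/imsetP => [[/imsetP[p _ ->] pU]|[p + ->]]; first by exists p; rewrite ?inE.
  by rewrite inE imset_f.
move=> U; rewrite !ptcI cardS => SU SU'.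
by apply: (classes_balanced (config_indep diff_inj)); rewrite card_ord.
Qed.
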